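(* Let $C_1,\dots,C_n$, $\Theta$, $D$, $h$, $a$, $\Theta^{(i)}$, $A$, $\mathcal{M}^{(i)}$, $F_{u^{(i)}}(\Lambda)$ be as in the context, and define the step function on $\mathbb{R}^m$ $$\rho(\Theta;x_1,\dots,x_m)=\sum_{j=1}^n\lfloor 1-\theta_j+C_j(x_1,\dots,x_m)\rfloor .$$ Suppose that for each $i=0,1,\dots,a-1$ we have $$\rho(\Theta^{(i)};x_1,\dots,x_m)\ge 0\quad\text{for all }x_1,\dots,x_m\in[0,1).$$ Then for $i=0,1,\dots,a-1$ and all $u^{(i)}\in\mathcal{M}^{(i)}$ the series $F_{u^{(i)}}(\Lambda)$ has $p$-integral coefficients for all primes $p\equiv h\pmod{D}$.
   Context: For $z\in\mathbb{C}$, $l\in\mathbb{Z}$ put $[z]_0=1$; $[z]_l=\frac{1}{(z+1)(z+2)\cdots(z+l)}$ if $l>0$ and $z\notin\{-1,\dots,-l\}$; $[z]_l=z(z-1)\cdots(z+l+1)$ if $l<0$. For tuples, $[z]_l=\prod_{j}[z_j]_{l_j}$. Let $c_{jk}\in\mathbb{Z}$ ($1\le j\le n$, $1\le k\le m$) and $C_j(s_1,\dots,s_m)=\sum_{k=1}^m c_{jk}s_k$. Assume: no $C_j$ is identically zero; for each $k$ at least two values of $j$ have $c_{jk}\ne0$; and $\sum_{j=1}^n c_{jk}=1$ for $k=1,\dots,m$. Let $\Theta=(\theta_1,\dots,\theta_n)$ be rational numbers in $[0,1]$ such that if $\theta_i=1$ then all $c_{ik}\ge 0$, and if $\theta_i=0$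 then all $c_{ik}\le 0$. Let $\mathbf{a}_1,\dots,\mathbf{a}_n$ be the standard basis vectors of $\mathbb{R}^n$, $\mathbf{a}_{n+k}=(c_{1k},\dots,c_{nk})$ for $k=1,\dots,m$, $N=n+m$, $A=\{\mathbf{a}_j\}_{j=1}^N$. Let $\mathbb{Z}A$ be the abelian group generated by $A$, $C(A)\subseteq\mathbb{R}^n$ the real cone generated by $A$, and $-C(A)^\circ$ the interior of $-C(A)$. Let $D$ be a positive integer with $D\theta_j\in\mathbb{Z}$ for all $j$, and $h$ a positive integer with $(h,D)=1$. For each rational $y\in[-1,0]$ with $Dy\in\mathbb{Z}$ there is a unique rational $y'\in[-1,0]$ with $Dy'\in\mathbb{Z}$ and $hy-y'\in\{0,-1,\dots,-(h-1)\}$. Let $y^{(i)}$ be the $i$-fold iterate of $y\mapsto y'$, and set $\theta_j^{(i)}=-(-\theta_j)^{(i)}\in[0,1]$, $\Theta^{(i)}=(\theta_1^{(i)},\dots,\theta_n^{(i)})$. Let $a$ be a positive integer with $\theta_j^{(a)}=\theta_j$ for all $j$. Put $v^{(i)}=(-\theta_1^{(i)},\dots,-\theta_n^{(i)},0,\dots,0)$ ($0$ repeated $m$ times), $\beta^{(i)}=\sum_{j=1}^N v_j^{(i)}\mathbf{a}_j=(-\theta_1^{(i)},\dots,-\theta_n^{(i)})$, and $\mathcal{M}^{(i)}=(\beta^{(i)}+\mathbb{Z}A)\cap(-C(A)^\circ)$. Let $E=\{l\in\mathbb{Z}^N\mid l_j\le0\text{ if }j\le n\text{ and }\theta_j=1;\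 l_j\ge0\text{ if }j\le n\text{ and }\theta_j=0,\text{ or if }j=n+1,\dots,n+m\}$. For $u^{(i)}\in\mathcal{M}^{(i)}$ let $E(u^{(i)})=\{l\in E\mid\sum_{j=1}^N(v^{(i)}_j+l_j)\mathbf{a}_j=u^{(i)}\}$ and define the formal series $$F_{u^{(i)}}(\Lambda_1,\dots,\Lambda_N)=\sum_{l\in E(u^{(i)})}[v^{(i)}]_l\,\Lambda^{v^{(i)}+l},\qquad \Lambda^{v^{(i)}+l}=\prod_{j=1}^N\Lambda_j^{v_j^{(i)}+l_j}.$$ *)

(* Defs.v *)
From HB Require Import structures.
From mathcomp Require Import all_boot all_order all_algebra.
From mathcomp Require Import all_classical all_reals all_analysis.
From mathcomp Require Import zify ring lra.
Set Implicit Arguments.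
Unset Strict Implicit.
Unset Printing Implicit Defensive.
Import Order.TTheory GRing.Theory Num.Theory.
Import numFieldNormedType.Exports.
Local Open Scope classical_set_scope.
Local Open Scope ring_scope.

(* [z]_l: 1/((z+1)...(z+l)) for l >= 0 and z(z-1)...(z+l+1) for l < 0; recall
   that Negz k is -(k+1).  When l > 0 and z is one of -1, ..., -l, where [z]_l
   is undefined, the value is the junk 0^-1 = 0. *)
Definition bracket (F : numFieldType) (z : F) (l : int) : F :=
  match l with
  | Posz k => (\prod_(i < k) (z + i.+1%:R))^-1
  | Negz k => \prod_(i < k.+1) (z - i%:R)
  end.

Definition brackets (F : numFieldType) (N : nat) (z : 'rV[F]_N)
    (l : 'rV[int]_N) : F :=
  \prod_(j < N) bracket (z 0 j) (l 0 j).

Definition p_integral (p : nat) (q : rat) : bool := ~~ (p %| `|denq q|)%N.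

(* A formal series in Lambda_1, ..., Lambda_N with rational exponents and
   rational coefficients is given by the coefficient of each Lambda^e. *)
Definition formal_series (N : nat) := 'rV[rat]_N -> rat.

Definition is_dwork_prime (D h : nat) (y y' : rat) : Prop :=
  [/\ -1 <= y' <= 0,
      D%:R * y' \is a Num.int
    & exists2 k : nat, (k < h)%N & h%:R * y - y' = - k%:R].

(* The map y |-> y'; see dwork_primeP and dwork_prime_unique. *)
Definition dwork_prime (D h : nat) (y : rat) : rat :=
  xget 0 [set y' | is_dwork_prime D h y y'].

Section DworkPrime.
Variables (D h : nat) (y : rat).
Hypotheses (D_gt0 : (0 < D)%N) (h_gt0 : (0 < h)%N).
Hypotheses (y_itv : -1 <= y <= 0) (Dy_int : D%:R * y \is a Num.int).

Lemma dwork_primeP : is_dwork_prime D h y (dwork_prime D h y).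
Proof.
apply: (@xgetPex _ 0 [set y' | is_dwork_prime D h y y']).
have h0 : (0 : rat) < h%:R by rewrite ltr0n.
have [y0|yN0] := eqVneq y 0.
  exists 0; split => //; first by rewrite mulr0 rpred0.
  by exists 0%N => //; rewrite y0 mulr0 subrr oppr0.
have ylt : y < 0 by rewrite lt_neqAle yN0; case/andP: y_itv.
set f := Num.floor (h%:R * y : rat).
have f1 : f%:~R <= h%:R * y by exact: floor_le.
have f2 : h%:R * y < f%:~R + 1 by rewrite -intrD1; exact: floorD1_gt.
have flt : f < 0 by rewrite floor_lt0 pmulr_rlt0.
have fge : - h%:Z <= f.
  rewrite floor_ge_int rmorphN /= -pmulrn.
  case/andP: y_itv => y1 _; nra.
have [g Eg] : exists g : nat, f = - (g.+1)%:Z by exists `|f|.-1%N; lia.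
have EgR : f%:~R = - (g%:R + 1) :> rat.
  by rewrite Eg rmorphN /= -pmulrn -natr1.
exists (h%:R * y - f%:~R - 1); split.
- by apply/andP; split; lra.
- have -> : D%:R * (h%:R * y - f%:~R - 1) =
            h%:R * (D%:R * y) - D%:R * f%:~R - D%:R by ring.
  apply: rpredB; last exact: natr_int.
  apply: rpredB; first by apply: rpredM => //; exact: natr_int.
  by apply: rpredM; [exact: natr_int | exact: intr_int].
- exists g; first lia.
  rewrite EgR; ring.
Qed.

Lemma dwork_prime_unique (y' : rat) : coprime h D ->
  is_dwork_prime D h y y' -> y' = dwork_prime D h y.
Proof.
move=> copr [y'_itv _ [k kh Ek]].
have [z_itv _ [j jh Ej]] := dwork_primeP.
set z := dwork_prime D h y in z_itv Ej *.
have [d Ed] := intrP Dy_int.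
have hd0 (i : nat) : (i < h)%N -> h%:R * y = - i%:R -> i = 0%N.
  move=> ih Ei.
  have Ehd : h%:Z * d = - (i%:Z * D%:Z).
    apply: (@intr_inj rat).
    rewrite rmorphN !rmorphM /= -Ed -!pmulrn mulrCA Ei; ring.
  have : (h %| i * D)%N.
    rewrite -[(i * D)%N]/`|(i * D)%N : int|%N PoszM.
    by rewrite -abszN -Ehd abszM dvdn_mulr.
  by rewrite Gauss_dvdl // /dvdn modn_small // => /eqP.
have [jk|kj|Ejk] := ltngtP j k; last by rewrite Ejk in Ej; lra.
- have : j%:R + 1 <= k%:R :> rat by rewrite natr1 ler_nat.
  move=> ?; have : k = 0%N by apply: hd0 => //; lra.
  lia.
- have : k%:R + 1 <= j%:R :> rat by rewrite natr1 ler_nat.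
  move=> ?; have : j = 0%N by apply: hd0 => //; lra.
  lia.
Qed.
End DworkPrime.

Section Series.
Context {R : realType} {n m : nat}.
Variables (c : 'M[int]_(n, m)) (theta : 'rV[rat]_n).

Definition lin_form (j : 'I_n) (s : 'I_m -> R) : R :=
  \sum_(k < m) (c j k)%:~R * s k.

Definition rho (t : 'rV[rat]_n) (x : 'I_m -> R) : int :=
  \sum_(j < n) Num.floor (1 - ratr (t 0 j) + lin_form j x).

(* The rows of col_mx 1%:M c^T are a_1, ..., a_(n+m). *)
Definition avec (j : 'I_(n + m)) : 'rV[R]_n :=
  map_mx intr (row j (col_mx 1%:M c^T)).

Definition ZA : set 'rV[R]_n :=
  [set \sum_j (l j)%:~R *: avec j | l in [set: 'I_(n + m) -> int]].

Definition coneA : set 'rV[R]_n :=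
  [set \sum_j t j *: avec j | t in [set t : 'I_(n + m) -> R | forall j, 0 <= t j]].

Definition theta_iter (D h i : nat) : 'rV[rat]_n :=
  \row_j - iter i (dwork_prime D h) (- theta 0 j).

Definition v_iter (D h i : nat) : 'rV[rat]_(n + m) :=
  row_mx (- theta_iter D h i) 0.

Definition beta_iter (D h i : nat) : 'rV[R]_n :=
  \sum_j ratr (v_iter D h i 0 j) *: avec j.

Definition M_iter (D h i : nat) : set 'rV[R]_n :=
  [set beta_iter D h i + z | z in ZA] `&` (-%R @` coneA)°.

Definition E_set : set 'rV[int]_(n + m) :=
  [set l | [/\ forall j : 'I_n, theta 0 j = 1 -> l 0 (lshift m j) <= 0,
               forall j : 'I_n, theta 0 j = 0 -> 0 <= l 0 (lshift m j)
             & forall k : 'I_m, 0 <= l 0 (rshift n k)]].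

Definition E_iter (D h i : nat) (u : 'rV[R]_n) : set 'rV[int]_(n + m) :=
  [set l | E_set l /\
     \sum_j ratr (v_iter D h i 0 j + (l 0 j)%:~R) *: avec j = u].

(* The coefficient of Lambda^e in the sum over l in E(u) of
   [v]_l Lambda^(v + l); at most one l contributes to it. *)
Definition F_series (D h i : nat) (u : 'rV[R]_n) : formal_series (n + m) :=
  fun e => \sum_(l \in [set l | E_iter D h i u l /\
                                v_iter D h i + map_mx intr l = e])
             brackets (v_iter D h i) l.

End Series.

(* Main.v *)
Require Import Defs.
From HB Require Import structures.
From mathcomp Require Import all_boot all_order all_algebra.
From mathcomp Require Import all_classical all_reals all_analysis.
From mathcomp Require Import zify ring lra.
Set Implicit Arguments.
Unset Strict Implicit.
Unset Printing Implicit Defensive.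
Import Order.TTheory GRing.Theory Num.Theory.
Import numFieldNormedType.Exports.
Local Open Scope classical_set_scope.
Local Open Scope ring_scope.

(** The bracket [z]_l is a signed product of the numbers [z + x], x between 0
    and l. For [z = - theta], the [x] with [p ^ r] dividing [z + x] form one
    residue class, so Legendre's formula gives
    [ord_p [- theta]_l = - sum_(r >= 1) floor ((l - theta) / p^r + theta_r)],
    where [theta_r] is the [r]-th preimage of [theta] under the Dwork map, hence
    again one of the iterates. With [l_j - theta_j = u_j - C_j(s)] and
    [- u = sum_j t_j a_j] with all [t_j > 0], the contribution of [p ^ r] to the
    order of a coefficient is
    [- sum_j floor (theta_(r,j) - C_j(y) - t_j / p^r) - sum_k floor (s_k / p^r)]
    at [y = (s + t) / p^r], which is at least [rho (Theta_r; {y}) >= 0]. So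
    every [r] contributes a nonnegative amount. *)

(** * The [p]-adic order on the rationals *)

(** The value at 0 is 0 instead of infinity, so multiplicativity requires nonzero arguments. *)
Definition rat_val (p : nat) (q : rat) : int :=
  (logn p `|numq q|)%:Z - (logn p `|denq q|)%:Z.

(** Cross-multiplication with the reduced fraction frees the order from lowest terms. *)
Lemma rat_valE (p : nat) (q : rat) (a b : int) :
  q != 0 -> b != 0 -> q * b%:~R = a%:~R ->
  rat_val p q = (logn p `|a|)%:Z - (logn p `|b|)%:Z.
Proof.
move=> q0 b0 qab.
have dq0 : denq q != 0 by exact: denq_neq0.
have nq0 : numq q != 0 by rewrite numq_eq0.
have E : numq q * b = a * denq q.
  by apply: (@intr_inj rat); rewrite !rmorphM /= numqE -qab; ring.
have a0 : a != 0 by apply: contra_neq (mulf_neq0 nq0 b0) => a0; rewrite E a0 mul0r.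
have := congr1 (fun x : int => logn p `|x|) E.
rewrite /= !abszM !lognM ?absz_gt0 // /rat_val; lia.
Qed.

Lemma rat_valM (p : nat) (q r : rat) :
  q != 0 -> r != 0 -> rat_val p (q * r) = rat_val p q + rat_val p r.
Proof.
move=> q0 r0.
rewrite (@rat_valE p (q * r) (numq q * numq r) (denq q * denq r)).
- rewrite !abszM !lognM ?absz_gt0 ?numq_eq0 ?denq_neq0 // /rat_val; lia.
- exact: mulf_neq0.
- by rewrite mulf_neq0 ?denq_neq0.
- by rewrite !rmorphM /= !numqE; ring.
Qed.

Lemma rat_val1 (p : nat) : rat_val p 1 = 0.
Proof. by rewrite (@rat_valE p 1 1 1) ?subrr. Qed.

Lemma rat_valV (p : nat) (q : rat) : q != 0 -> rat_val p q^-1 = - rat_val p q.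
Proof.
move=> q0; apply: (addIr (rat_val p q)).
by rewrite addNr -rat_valM ?invr_eq0 // mulVf // rat_val1.
Qed.

Lemma rat_val_prod (p : nat) (I : finType) (F : I -> rat) :
  \prod_i F i != 0 -> rat_val p (\prod_i F i) = \sum_i rat_val p (F i).
Proof.
move=> /prodf_neq0 F0.
suff [] : rat_val p (\prod_i F i) = \sum_i rat_val p (F i) /\ \prod_i F i != 0.
  by [].
apply: (big_rec2 (fun x s => rat_val p x = s /\ x != 0)).
  by rewrite rat_val1 oner_eq0.
move=> i x s _ [<- s0]; rewrite rat_valM ?F0 // mulf_neq0 ?F0 //.
Qed.

Lemma p_integral_rat_val (p : nat) (q : rat) :
  prime p -> 0 <= rat_val p q -> p_integral p q.
Proof.
move=> pp; rewrite /p_integral /rat_val subr_ge0; apply: contraTN => pd.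
have dgt0 : (0 < `|denq q|)%N by rewrite absz_gt0 denq_neq0.
have : (0 < logn p `|denq q|)%N by rewrite -pfactor_dvdn // expn1.
have : logn p `|numq q| = 0%N.
  rewrite logn_coprime // (coprime_dvdl pd) // coprime_sym.
  exact: coprime_num_den.
lia.
Qed.

(** * Legendre's formula for the brackets *)

(** The terms with [r >= n] vanish because [p ^ r > r]. A free cutoff [M] lets different numbers
    share one range of summation. *)
Lemma logn_count_dvd_le (p n M : nat) : prime p -> (0 < n <= M)%N ->
  logn p n = (\sum_(1 <= r < M) (p ^ r %| n))%N.
Proof.
move=> pp /andP[n0 nM]; rewrite (logn_count_dvd n pp).
rewrite (@big_cat_nat _ _ _ n 1 M) //= [X in _ = (_ + X)%N]big_nat.
rewrite [X in _ = (_ + X)%N]big1 ?addn0 // => r /andP[nr _].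
by rewrite gtnNdvd // (leq_ltn_trans nr) // ltn_expl // prime_gt1.
Qed.

(** The floor of [x / d] jumps exactly at multiples of [d]; written this way, divisibility counts
    telescope. *)
Lemma divz_sub_pred (x : int) (d : nat) : (0 < d)%N ->
  (x %/ d)%Z - ((x - 1) %/ d)%Z = (d %| `|x|)%N.
Proof.
move=> d0; have -> : (d %| `|x|)%N = (d%:Z %| x)%Z by [].
have d0' : d%:Z != 0 by lia.
have := divz_eq x d; have := divz_eq (x - 1) d.
have := modz_ge0 x d0'; have := modz_ge0 (x - 1) d0'.
have := @ltz_mod x d d0'; have := @ltz_mod (x - 1) d d0'.
rewrite (sameP dvdz_mod0P eqP).
move: (x %/ d)%Z ((x - 1) %/ d)%Z (x %% d)%Z ((x - 1) %% d)%Z => q1 q2 r1 r2.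
case: eqP => h ? ? ? ? ? ?; nia.
Qed.

(* A power [p ^ r] divides the numerator [D x + T] of [z + x] exactly when it
   divides [x + kap r], because [kap r] is congruent to [z] modulo [p ^ r]. *)
Lemma rat_val_shift (p D M : nat) (z : rat) (T : int) (y : nat -> rat)
    (kap : nat -> nat) (x : int) :
  prime p -> coprime p D -> (0 < D)%N ->
  D%:R * z = T%:~R -> (forall r, D%:R * y r \is a Num.int) ->
  (forall r, (p ^ r)%:R * y r - z = - (kap r)%:R) ->
  z + x%:~R != 0 -> (`|T| + D * `|x| <= M)%N ->
  rat_val p (z + x%:~R) =
    \sum_(1 <= r < M) (((x + (kap r)%:Z) %/ (p ^ r)%N)%Z -
                       ((x - 1 + (kap r)%:Z) %/ (p ^ r)%N)%Z).
Proof.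
move=> pp pD D0 zT yint ykap zx0 TM.
have D0' : D%:R != 0 :> rat by rewrite pnatr_eq0 -lt0n.
have E : (z + x%:~R) * (D%:Z)%:~R = (T + D%:Z * x)%:~R.
  by rewrite rmorphD rmorphM /= -zT -!pmulrn; ring.
have W0 : T + D%:Z * x != 0.
  by rewrite -(intr_eq0 rat) -E mulf_neq0.
rewrite (rat_valE p zx0 _ E); last lia.
rewrite [logn p `|D%:Z|]logn_coprime // subr0.
rewrite (@logn_count_dvd_le p _ M) //; last by apply/andP; split; nia.
rewrite (big_morph Posz PoszD (erefl _)); apply: eq_bigr => r _.
have pr0 : (0 < p ^ r)%N by rewrite expn_gt0 prime_gt0.
have [S ES] := intrP (yint r).
have ET : T + D%:Z * x = (p ^ r)%N%:Z * S + D%:Z * (x + (kap r)%:Z).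
  apply: (@intr_inj rat); rewrite !(rmorphD, rmorphM) /= -zT -ES -!pmulrn.
  have -> : (kap r)%:R = z - (p ^ r)%:R * y r :> rat by rewrite -opprB ykap opprK.
  ring.
rewrite addrAC divz_sub_pred //; congr (Posz (nat_of_bool _)).
rewrite -[LHS]/((p ^ r)%N%:Z %| T + D%:Z * x)%Z ET.
have dvdl : ((p ^ r)%N%:Z * S \in dvdz (p ^ r)%N) by exact: dvdz_mulr.
rewrite (rpredDl _ dvdl).
by rewrite Gauss_dvdzr // /coprimez /gcdz /= -[_ == _]/(coprime _ _) coprimeXl.
Qed.

(** The orders of the factors telescope in [l], and the term at [l = 0] vanishes because
    [kap r < p ^ r]. *)
Lemma rat_val_bracket (p D M : nat) (z : rat) (T : int) (y : nat -> rat)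
    (kap : nat -> nat) (l : int) :
  prime p -> coprime p D -> (0 < D)%N ->
  D%:R * z = T%:~R -> (forall r, D%:R * y r \is a Num.int) ->
  (forall r, (p ^ r)%:R * y r - z = - (kap r)%:R) ->
  (forall r, (kap r < p ^ r)%N) ->
  bracket z l != 0 -> (`|T| + D * `|l| <= M)%N ->
  rat_val p (bracket z l) =
    - \sum_(1 <= r < M) ((l + (kap r)%:Z) %/ (p ^ r)%N)%Z.
Proof.
move=> pp pD D0 zT yint ykap kap_lt.
have kap0 r : ((kap r)%:Z %/ (p ^ r)%N)%Z = 0.
  by apply: divz_small; rewrite lez_nat ltz_nat kap_lt.
case: l => k /=.
- rewrite invr_eq0 => P0 kM; rewrite rat_valV //; congr (- _).
  elim: k P0 kM => [|k IH].
    move=> _ _; rewrite big_ord0 rat_val1 big1 // => r _; rewrite add0r; exact: kap0.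
  rewrite big_ord_recr /= mulf_eq0 negb_or => /andP[P0 z0] kM.
  rewrite rat_valM // IH //; last nia.
  rewrite [k.+1%:R]pmulrn in z0 *.
  rewrite (@rat_val_shift _ _ _ _ _ _ _ _ pp pD D0 zT yint ykap z0 kM).
  rewrite -big_split /=; apply: eq_bigr => r _.
  have -> : k.+1%:Z - 1 = k by lia.
  by rewrite addrC subrK.
(* The factors now start at [z] itself, so the factor [z - k] accounts for the step from [- k] to
   [- k - 1]. *)
- rewrite NegzE; elim: k.+1 => {k} [|k IH].
    move=> _ _; rewrite big_ord0 rat_val1 big1 ?oppr0 // => r _.
    rewrite -[RHS](kap0 r). by rewrite add0r.
  rewrite big_ord_recr /= mulf_eq0 negb_or => /andP[P0 z0] kM.
  rewrite rat_valM // IH //; last nia.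
  have kE : - k%:R = (- k%:Z)%:~R :> rat by rewrite rmorphN /= -pmulrn.
  rewrite kE in z0 *.
  rewrite (@rat_val_shift _ _ M _ _ _ _ _ pp pD D0 zT yint ykap z0); last nia.
  rewrite -!sumrN -big_split /=; apply: eq_bigr => r _.
  have -> : - k.+1%:Z = - k%:Z - 1 by lia.
  by rewrite addrA addNr add0r.
Qed.

(** * The Dwork map for a prime congruent to [h] and its iterates *)

(** Since [D y] is an integer, changing [h] by a multiple of [D] keeps [h y - y'] integral; the
    range of the new difference then follows from the size of [y] and [y']. *)
Lemma is_dwork_prime_mod (D h p : nat) (y y' : rat) :
  (0 < D)%N -> (0 < h)%N -> (0 < p)%N -> p = h %[mod D] ->
  -1 <= y <= 0 -> D%:R * y \is a Num.int ->
  is_dwork_prime D h y y' -> is_dwork_prime D p y y'.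
Proof.
move=> D0 h0 p0 ph yitv Dy [y'itv Dy' [k kh hyk]]; split => //.
have p0r : 1 <= p%:R :> rat by rewrite ler1n.
have [g Eg] : exists g : int, p%:R * y - y' = g%:~R.
  have [s Es] := intrP Dy.
  have [q Eq] : exists q : int, p%:Z = h%:Z + q * D%:Z.
    exists ((p %/ D)%:Z - (h %/ D)%:Z).
    rewrite {1}(divn_eq p D) {1}(divn_eq h D) ph; lia.
  exists (q * s - k%:Z); rewrite rmorphB rmorphM /= -Es -[k%:~R]pmulrn.
  have -> : p%:R = h%:R + q%:~R * D%:R :> rat.
    by rewrite !pmulrn Eq rmorphD rmorphM.
  rewrite -[RHS]addrC -hyk; ring.
clear ph Dy Dy'.
suff [g0 gp] : g%:~R <= 0 :> rat /\ - p%:R < g%:~R :> rat.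
  have [gN gP] : g <= 0 /\ - p%:Z < g.
    by split; rewrite -?(ler_int rat) -?(ltr_int rat) ?rmorphN /= -?pmulrn.
  exists `|g|%N; first lia.
  by rewrite Eg pmulrn -rmorphN /=; congr (_%:~R); lia.
rewrite -Eg.
have h0r : 1 <= h%:R :> rat by rewrite ler1n.
have khr : k%:R + 1 <= h%:R :> rat by rewrite natr1 ler_nat.
have k0r : 0 <= k%:R :> rat by rewrite ler0n.
(* At the endpoints 0 and -1 size alone does not suffice; there [hyk] forces [y' = y]. *)
have [y0|yN0] := eqVneq y 0.
  by rewrite y0 in hyk *; split; lra.
have [y1|yN1] := eqVneq y (-1).
  rewrite y1 in hyk *; split; lra.
have y_lt0 : y < 0 by rewrite lt_neqAle yN0; case/andP: yitv.
have y_gt : -1 < y by rewrite lt_neqAle eq_sym yN1; case/andP: yitv.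
split; last nra.
rewrite Eg lerz0 -ltzD1 add0r -(ltr_int rat) -Eg; nra.
Qed.

Lemma dwork_prime_iter_itv (D h : nat) (y : rat) (i : nat) :
  (0 < D)%N -> (0 < h)%N -> -1 <= y <= 0 -> D%:R * y \is a Num.int ->
  -1 <= iter i (dwork_prime D h) y <= 0 /\
  D%:R * iter i (dwork_prime D h) y \is a Num.int.
Proof.
move=> D0 h0 yitv Dy; elim: i => [|i [itv int]] //=.
by have [] := dwork_primeP D0 h0 itv int.
Qed.

(** The successive differences are the base [p] digits of [k], most significant first. *)
Lemma dwork_prime_iter_carry (D h p : nat) (y : rat) (r : nat) :
  (0 < D)%N -> (0 < h)%N -> (0 < p)%N -> p = h %[mod D] ->
  -1 <= y <= 0 -> D%:R * y \is a Num.int ->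
  exists2 k : nat, (k < p ^ r)%N &
    (p ^ r)%:R * y - iter r (dwork_prime D h) y = - k%:R.
Proof.
move=> D0 h0 p0 ph yitv Dy; elim: r => [|r [k kp IH]].
  by exists 0%N => //=; rewrite expn0 mul1r subrr oppr0.
have [itv int] := dwork_prime_iter_itv r D0 h0 yitv Dy.
have := is_dwork_prime_mod D0 h0 p0 ph itv int (dwork_primeP D0 h0 itv int).
case=> _ _ [j jp Ej]; exists (p * k + j)%N.
  by rewrite expnS; nia.
rewrite iterS expnS natrD !natrM.
set z := iter r _ _ in IH Ej *; set w := dwork_prime _ _ _ in Ej *.
have -> : w = p%:R * z + j%:R by lra.
have -> : z = (p ^ r)%:R * y + k%:R by lra.
ring.
Qed.

(** * The step function and the interior of the cone *)

(* Since [floor b + floor b' <= 0] when [b + b' < 1], each [g j] is at most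
   [- floor (1 - t_j + C_j(y))]. By [c_sum], replacing [y] with its fractional
   part changes the sum of these floors by the sum of the [floor (y k)]. *)
Lemma floor_sum_le (R : realType) (n m : nat) (c : 'M[int]_(n, m))
    (t : 'rV[rat]_n) (y : 'I_m -> R) (g : 'I_n -> int) (e : 'I_m -> int) :
  (forall k, \sum_j c j k = 1) ->
  (forall x : 'I_m -> R, (forall k, 0 <= x k < 1) -> 0 <= rho c t x) ->
  (forall j, (g j)%:~R + lin_form c j y < ratr (t 0 j)) ->
  (forall k, (e k)%:~R <= y k) ->
  \sum_j g j + \sum_k e k <= 0.
Proof.
move=> c_sum rho0 gt ey.
pose f k : int := Num.floor (y k).
have fk k : (f k)%:~R <= y k < (f k)%:~R + 1.
  by rewrite floor_le -intrD1 floorD1_gt.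
have /rho0 : forall k, 0 <= y k - (f k)%:~R < 1 by move=> k; have := fk k; lra.
have ef : \sum_k e k <= \sum_k f k by apply: ler_sum => k _; rewrite floor_ge_int.
suff : rho c t (fun k => y k - (f k)%:~R) + \sum_k f k + \sum_j g j <= 0 by lia.
have -> : \sum_k f k = \sum_j \sum_k c j k * f k.
  by rewrite exchange_big; apply: eq_bigr => k _; rewrite -mulr_suml c_sum mul1r.
rewrite /rho -!big_split /= -oppr_ge0 -sumrN; apply: sumr_ge0 => j _.
have -> : lin_form c j (fun k => y k - (f k)%:~R) =
    lin_form c j y - (\sum_k c j k * f k)%:~R.
  rewrite /lin_form rmorph_sum -sumrB; apply: eq_bigr => k _.
  by rewrite mulrBr rmorphM.
set s := \sum_k _; set F := Num.floor _.
have := floor_le (1 - ratr (t 0 j) + (lin_form c j y - s%:~R)); rewrite -/F => FE.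
suff : F + s + g j < 1 by lia.
by rewrite -(ltr_int R) !rmorphD /=; have := gt j; lra.
Qed.

Lemma sum_avec (R : realType) (n m : nat) (c : 'M[int]_(n, m))
    (w : 'I_(n + m) -> R) (j : 'I_n) :
  (\sum_i w i *: avec c i) 0 j =
  w (lshift m j) + lin_form c j (fun k => w (rshift n k)).
Proof.
have avecl i : avec c (lshift m i) 0 j = (i == j)%:R :> R.
  by rewrite mxE [row _ _ _ _]mxE col_mxEu mxE; case: eqP.
have avecr k : avec c (rshift n k) 0 j = (c j k)%:~R :> R.
  by rewrite mxE [row _ _ _ _]mxE col_mxEd mxE.
rewrite summxE big_split_ord /=; congr (_ + _).
  rewrite (bigD1 j) //= big1 ?addr0 => [|i /negPf ij].
    by rewrite mxE avecl eqxx mulr1.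
  by rewrite mxE avecl ij mulr0.
by apply: eq_bigr => k _; rewrite mxE avecr mulrC.
Qed.

(* Subtracting a small multiple of the sum of all the generators from an interior
   point stays inside the cone. *)
Lemma interior_coneA (R : realType) (n m : nat) (c : 'M[int]_(n, m))
    (u : 'rV[R]_n) : (-%R @` coneA c)° u ->
  exists2 t : 'I_(n + m) -> R, forall i, 0 < t i & - u = \sum_i t i *: avec c i.
Proof.
move=> intu.
pose w : 'rV[R]_n := \sum_i avec c i.
have cvg : (u + d *: w) @[d --> (0 : R)^'+] --> u.
  rewrite -[X in _ --> X]addr0 -[X in _ + X](scale0r w).
  apply: cvgD; first exact: cvg_cst.
  by apply: cvgZr_tmp; apply: cvg_at_right_filter; exact: cvg_id.
have /filter_ex [d [d0 [z [t t0 <-] zE]]] :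
    \forall d \near (0 : R)^'+, 0 < d /\ (-%R @` coneA c) (u + d *: w).
  near=> d; split; first by near: d; exact: nbhs_right_gt.
  near: d; exact: (cvg _ intu).
exists (fun i => t i + d) => [i|]; first by rewrite ltr_wpDl.
under eq_bigr do rewrite scalerDl; rewrite big_split /= -scaler_sumr -/w.
by rewrite -[X in X + _]opprK zE opprD addrNK.
Unshelve. all: by end_near.
Qed.

(** * Periodicity of the exponents and the coefficients of the series *)

Lemma dwork_prime0 (D h : nat) : (0 < D)%N -> (0 < h)%N -> dwork_prime D h 0 = 0.
Proof.
move=> D0 h0.
have [/andP[_ y0] _ [k _ Ek]] : is_dwork_prime D h 0 (dwork_prime D h 0).
  by apply: dwork_primeP; rewrite ?mulr0 ?rpred0.
have : 0 <= k%:R :> rat by rewrite ler0n.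
lra.
Qed.

(** As 0 is fixed by the Dwork map, the zero block also consists of iterates, and all [n + m]
    coordinates can be treated alike. *)
Lemma v_iterE (n m : nat) (theta : 'rV[rat]_n) (D h i : nat) (j : 'I_(n + m)) :
  (0 < D)%N -> (0 < h)%N ->
  v_iter theta D h i 0 j = iter i (dwork_prime D h) (row_mx (- theta) 0 0 j).
Proof.
move=> D0 h0; rewrite /v_iter; case: (split_ordP j) => k ->.
  by rewrite !row_mxEl !mxE opprK.
by rewrite !row_mxEr !mxE iter_fix // dwork_prime0.
Qed.

Lemma theta_iter_addM (n : nat) (theta : 'rV[rat]_n) (D h a i r : nat) :
  theta_iter theta D h a = theta ->
  theta_iter theta D h (i + r * a) = theta_iter theta D h i.
Proof.
move=> theta_a; elim: r => [|r IH]; first by rewrite mul0n addn0.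
rewrite -IH mulSn addnCA addnC; apply/rowP => j; rewrite !mxE iterD.
by have /rowP/(_ j) := theta_a; rewrite mxE => E; rewrite -[in RHS]E opprK.
Qed.

(** The exponent determines [l], so the sum has at most one term. *)
Lemma F_series_coef (R : realType) (n m : nat) (c : 'M[int]_(n, m))
    (theta : 'rV[rat]_n) (D h i : nat) (u : 'rV[R]_n) (e : 'rV[rat]_(n + m)) :
  F_series c theta D h i u e = 0 \/
  exists2 l, E_iter c theta D h i u l &
    F_series c theta D h i u e = brackets (v_iter theta D h i) l.
Proof.
rewrite /F_series; set A := [set _ | _].
have [[l [El le]]|nA] := pselect (exists l, A l); last first.
  left; suff -> : A = set0 by rewrite fsbig_set0.
  by apply/seteqP; split => // l Al; apply: nA; exists l.
right; exists l => //; suff -> : A = [set l] by rewrite fsbig_set1.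
apply/seteqP; split => [l' [_ l'e]|_ -> //].
apply/rowP => j; move: le; rewrite -l'e => /addrI/rowP/(_ j).
by rewrite !mxE => /intr_inj.
Qed.

Lemma lin_form_shift (R : realType) (n m : nat) (c : 'M[int]_(n, m)) (j : 'I_n)
    (x y : 'I_m -> R) (d : R) :
  lin_form c j (fun k => (x k + y k) / d) = (lin_form c j x + lin_form c j y) / d.
Proof.
rewrite /lin_form -big_split mulr_suml; apply: eq_bigr => k _ /=.
by rewrite mulrA mulrDr.
Qed.

Theorem theorem12p15 (R : realType) (n m : nat) (c : 'M[int]_(n, m))
    (theta : 'rV[rat]_n) (D h a : nat)
    (C_neq0 : forall j : 'I_n, exists s : 'I_m -> R, lin_form c j s != 0)
    (c_two : forall k : 'I_m, (2 <= #|[set j : 'I_n | c j k != 0%R]%SET|)%N)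
    (c_sum : forall k : 'I_m, \sum_(j < n) c j k = 1)
    (theta_itv : forall j : 'I_n, 0 <= theta 0 j <= 1)
    (theta_1 : forall j : 'I_n, theta 0 j = 1 -> forall k : 'I_m, 0 <= c j k)
    (theta_0 : forall j : 'I_n, theta 0 j = 0 -> forall k : 'I_m, c j k <= 0)
    (D_gt0 : (0 < D)%N)
    (D_theta : forall j : 'I_n, D%:R * theta 0 j \is a Num.int)
    (h_gt0 : (0 < h)%N)
    (h_D : coprime h D)
    (a_gt0 : (0 < a)%N)
    (theta_a : theta_iter theta D h a = theta)
    (rho_ge0 : forall i : nat, (i < a)%N -> forall x : 'I_m -> R,
      (forall k : 'I_m, 0 <= x k < 1) ->
      0 <= rho c (theta_iter theta D h i) x) :
  forall i : nat, (i < a)%N ->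
  forall u : 'rV[R]_n, M_iter c theta D h i u ->
  forall p : nat, prime p -> p = h %[mod D] ->
  forall e : 'rV[rat]_(n + m), p_integral p (F_series c theta D h i u e).
Proof.
move=> i _ u [_ /interior_coneA[t t_gt0 uE]] p p_prime ph e.
have p_gt0 := prime_gt0 p_prime.
have pD : coprime p D by rewrite -coprime_modl ph coprime_modl.
have pint0 : p_integral p 0 by rewrite /p_integral dvdn1 neq_ltn prime_gt1 ?orbT.
have [->//|[l [_ lE] ->]] := F_series_coef c theta D h i u e.
(* The junk value of an undefined bracket is 0, so this case covers it too. *)
have [->//|nz] := eqVneq (brackets (v_iter theta D h i) l) 0.
apply: p_integral_rat_val => //; rewrite rat_val_prod //.
set v0 := row_mx (- theta) (0 : 'rV[rat]_m).
have v0_itv j : -1 <= v0 0 j <= 0.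
  rewrite /v0; case: (split_ordP j) => k ->; rewrite ?row_mxEl ?row_mxEr !mxE //.
  by have := theta_itv k; lra.
have v0_int j : D%:R * v0 0 j \is a Num.int.
  rewrite /v0; case: (split_ordP j) => k ->; rewrite ?row_mxEl ?row_mxEr !mxE.
    by rewrite mulrN rpredN.
  by rewrite mulr0 rpred0.
have v_itv_int k (j : 'I_(n + m)) : -1 <= v_iter theta D h k 0 j <= 0 /\
    D%:R * v_iter theta D h k 0 j \is a Num.int.
  rewrite v_iterE //.
  exact: (dwork_prime_iter_itv k D_gt0 h_gt0 (v0_itv j) (v0_int j)).
have v_l k j : v_iter theta D h k 0 (lshift m j) = - theta_iter theta D h k 0 j.
  by rewrite /v_iter row_mxEl mxE.
have v_r k j : v_iter theta D h k 0 (rshift n j) = 0 :> rat.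
  by rewrite /v_iter row_mxEr mxE.
(* Periodicity makes the (i + r(a-1))-th iterate the r-fold preimage of the
   i-th one. *)
pose w (r : nat) := (i + r * a.-1)%N.
have wa r : (r + w r = i + r * a)%N by rewrite /w; nia.
have v_carry (jr : 'I_(n + m) * nat) : exists k : nat, (k < p ^ jr.2)%N /\
    (p ^ jr.2)%:R * v_iter theta D h (w jr.2) 0 jr.1 -
      v_iter theta D h i 0 jr.1 = - k%:R.
  case: jr => j r /=; have [itv int] := v_itv_int (w r) j.
  have [k kp kE] := dwork_prime_iter_carry r D_gt0 h_gt0 p_gt0 ph itv int.
  exists k; split=> //; rewrite -kE; congr (_ - _).
  have -> : v_iter theta D h i = v_iter theta D h (i + r * a) :> 'rV_(n + m).
    by rewrite /v_iter theta_iter_addM.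
  by rewrite -wa !v_iterE // iterD.
have [kap kapP] := choice v_carry.
have [T TE] := choice (fun j => intrP (v_itv_int i j).2).
(* One cutoff for all coordinates, so that the sums over [j] and [r] can be exchanged. *)
pose M := (\sum_j (`|T j| + D * `|l 0%R j|))%N.
have valE (j : 'I_(n + m)) : rat_val p (bracket (v_iter theta D h i 0 j) (l 0 j)) =
    - \sum_(1 <= r < M) ((l 0%R j + (kap (j, r))%:Z) %/ (p ^ r)%N)%Z.
  apply: (rat_val_bracket (y := fun r => v_iter theta D h (w r) 0 j)
            (kap := fun r => kap (j, r)) p_prime pD D_gt0 (TE j)).
  - by move=> r; have [] := v_itv_int (w r) j.
  - by move=> r; have [] := kapP (j, r).
  - by move=> r; have [] := kapP (j, r).
  - by move: nz; rewrite /brackets => /prodf_neq0; exact.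
  - by rewrite /M (bigD1 j) //= leq_addr.
rewrite (eq_bigr _ (fun j _ => valE j)) sumrN oppr_ge0 exchange_big /=.
apply: sumr_le0 => r _; rewrite big_split_ord /=.
have P_gt0 : (0 : R) < (p ^ r)%:R by rewrite ltr0n expn_gt0 p_gt0.
have kapR j : (kap (j, r))%:R = ratr (v_iter theta D h i 0 j) -
    (p ^ r)%:R * ratr (v_iter theta D h (w r) 0 j) :> R.
  have [_ /(congr1 (ratr : rat -> R))] := kapP (j, r).
  rewrite rmorphB rmorphN rmorphM /= !ratr_nat => kE.
  by rewrite -[LHS]opprK -kE opprB.
have divle (x : int) (k : nat) :
    ((x + k%:Z) %/ (p ^ r)%N)%Z%:~R * (p ^ r)%:R <= x%:~R + k%:R :> R.
  rewrite !pmulrn -intrM -intrD ler_int; apply: lez_floor.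
  by rewrite -lt0n expn_gt0 p_gt0.
pose y k := ((l 0 (rshift n k))%:~R + t (rshift n k)) / (p ^ r)%:R.
apply: (@floor_sum_le R n m c (theta_iter theta D h (w r)) y) => //.
(* Reducing [w r] modulo [a] brings the index into the range of [rho_ge0]. *)
- move=> x x01; rewrite (divn_eq (w r) a) addnC theta_iter_addM //.
  by apply: rho_ge0 => //; rewrite ltn_mod.
(* After multiplication by [p ^ r], the two expressions for [u] cancel and leave [- t_j < 0]. *)
- move=> j; rewrite -(ltr_pM2r P_gt0) mulrDl /y lin_form_shift divfK ?gt_eqF //.
  apply: le_lt_trans (lerD (divle _ _) (lexx _)) _.
  rewrite kapR !v_l !rmorphN /=.
  have := congr1 (fun z : 'rV[R]_n => z 0 j) uE; rewrite mxE sum_avec.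
  have := congr1 (fun z : 'rV[R]_n => z 0 j) lE; rewrite /= sum_avec.
  rewrite v_l rmorphD rmorphN /= ratr_int.
  have -> : (fun k => ratr (v_iter theta D h i 0 (rshift n k) +
                            (l 0 (rshift n k))%:~R)) =
            (fun k => (l 0 (rshift n k))%:~R) :> ('I_m -> R).
    by apply/funext => k; rewrite v_r add0r ratr_int.
  have := t_gt0 (lshift m j); rewrite mulrC; lra.
(* On the last [m] coordinates [v] is 0, so the carry [kap] is 0 as well. *)
- move=> k; rewrite /y ler_pdivlMr //.
  apply: le_trans (divle _ _) _; rewrite kapR !v_r rmorph0 mulr0 subr0.
  by rewrite lerD2l ltW.
Qed.
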